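(* Let $X=(X_m)_{m\ge0}$ be a cyclic object in a category of modules, with face operators $\mathrm{d}_i$ and (signed) cyclic operator $\mathrm{t}$. Let $\mathcal K(X)$ be the module of sequences $x=(x_m)_{m\ge0}$, $x_m\in X_m$, such that $$\mathrm{t}(x_m)=(-1)^m x_m\quad (m\ge0),\qquad \mathrm{d}_i x_m=x_{m-1}\quad (m\ge1,\ 0\le i\le m).$$ Then for every $x\in\mathcal K(X)$ and every $n\ge0$ the chain $$\mathrm{ch}_n(x)=\sum_{m=0}^{2n}(-1)^{\lfloor m/2\rfloor}\frac{m!}{\lfloor m/2\rfloor!}\,x_m$$ is a cycle of degree $2n$ in $\mathrm{Tot}\,\mathrm{CC}(X)$, and the homology classes of these cycles form a sequence stable under Connes' periodicity operator $S$, i.e. $S[\mathrm{ch}_n(x)]=[\mathrm{ch}_{n-1}(x)]$ for all $n\ge1$.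
   Context: The cyclic operator carries the sign, as in Loday's book: $\mathrm t:X_m\to X_m$ satisfies $\mathrm t^{m+1}=1$, $\mathrm d_i\mathrm t=-\mathrm t\,\mathrm d_{i-1}$ for $1\le i\le m$ and $\mathrm d_0\mathrm t=(-1)^m\mathrm d_m$. For example, for an algebra $R$ one has $X_m=R^{\otimes(m+1)}$ and $\mathrm t(r^0\otimes\cdots\otimes r^m)=(-1)^m r^m\otimes r^0\otimes\cdots\otimes r^{m-1}$. On $X_m$ put $\mathrm b=\sum_{i=0}^m(-1)^i\mathrm d_i$, $\mathrm b'=\sum_{i=0}^{m-1}(-1)^i\mathrm d_i$, $\mathrm N=\sum_{i=0}^m\mathrm t^i$. $\mathrm{CC}(X)$ is the first-quadrant bicomplex with $X_q$ in column $p\ge0$, row $q\ge0$, vertical differential $\mathrm b$ in even columns and $-\mathrm b'$ in odd columns, and horizontal differential $1-\mathrm t$ from odd columns and $\mathrm N$ from even columns of index $\ge2$, each to the preceding column. Thus $\mathrm{Tot}\,\mathrm{CC}_{n}(X)=\bigoplus_{m=0}^{n}X_m$, with $X_m$ in column $n-m$. The homology of $\mathrm{Tot}\,\mathrm{CC}(X)$ is $\mathrm{HC}_\bullet(X)$, and $S:\mathrm{HC}_{n}(X)\to\mathrm{HC}_{n-2}(X)$ is induced by the quotient map of $\mathrm{CC}(X)$ by its first two columns, identified with a shift of $\mathrm{CC}(X)$. *)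

(* Defs.v *)
From HB Require Import structures.
From mathcomp Require Import all_boot all_order all_algebra.
From mathcomp Require Import boolp.

Set Implicit Arguments.
Unset Strict Implicit.
Unset Printing Implicit Defensive.

Import GRing.Theory.
Local Open Scope ring_scope.

(* Products of families of modules. For a finite index type this is also the  *)
(* direct sum.                                                                *)
Section ProductModule.
Variables (R : pzRingType) (I : Type) (V : I -> lmodType R).

Definition prodmod : Type := forall i, V i.

HB.instance Definition _ := gen_eqMixin prodmod.
HB.instance Definition _ := gen_choiceMixin prodmod.

Implicit Types x y z : prodmod.

Definition prodmod_zero : prodmod := fun=> 0.
Definition prodmod_opp x : prodmod := fun i => - x i.
Definition prodmod_add x y : prodmod := fun i => x i + y i.
Definition prodmod_scale (a : R) x : prodmod := fun i => a *: x i.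

Fact prodmod_addA : associative prodmod_add.
Proof. by move=> x y z; apply: functional_extensionality_dep => i; apply: addrA. Qed.
Fact prodmod_addC : commutative prodmod_add.
Proof. by move=> x y; apply: functional_extensionality_dep => i; apply: addrC. Qed.
Fact prodmod_add0 : left_id prodmod_zero prodmod_add.
Proof. by move=> x; apply: functional_extensionality_dep => i; apply: add0r. Qed.
Fact prodmod_addN : left_inverse prodmod_zero prodmod_opp prodmod_add.
Proof. by move=> x; apply: functional_extensionality_dep => i; apply: addNr. Qed.

HB.instance Definition _ := GRing.isZmodule.Build prodmod
  prodmod_addA prodmod_addC prodmod_add0 prodmod_addN.

Fact prodmod_scaleA a b x :
  prodmod_scale a (prodmod_scale b x) = prodmod_scale (a * b) x.
Proof. by apply: functional_extensionality_dep => i; apply: scalerA. Qed.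
Fact prodmod_scale1 : left_id 1 prodmod_scale.
Proof. by move=> x; apply: functional_extensionality_dep => i; apply: scale1r. Qed.
Fact prodmod_scaleDr : right_distributive prodmod_scale +%R.
Proof. by move=> a x y; apply: functional_extensionality_dep => i; apply: scalerDr. Qed.
Fact prodmod_scaleDl x : {morph prodmod_scale^~ x : a b / a + b}.
Proof. by move=> a b; apply: functional_extensionality_dep => i; apply: scalerDl. Qed.

HB.instance Definition _ := GRing.Zmodule_isLmodule.Build R prodmod
  prodmod_scaleA prodmod_scale1 prodmod_scaleDr prodmod_scaleDl.

Lemma prodmodP x y : (forall i, x i = y i) -> x = y.
Proof. exact: functional_extensionality_dep. Qed.

End ProductModule.

(* Chain complexes in nonnegative degrees, and their homology as the quotient *)
(* of the module of cycles by the submodule of boundaries.                    *)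
Record chainComplex (R : pzRingType) := ChainComplex {
  ch_obj :> nat -> lmodType R;
  ch_diff : forall n, {linear ch_obj n.+1 -> ch_obj n};
  ch_diffK : forall n (x : ch_obj n.+2), ch_diff n (ch_diff n.+1 x) = 0 }.
Arguments ch_diff {R} C n : rename.

Section Homology.
Variables (R : pzRingType) (C : chainComplex R) (n : nat).

(* The differential out of degree 0 is zero. *)
Definition ch_cycles : {pred C n} :=
  match n return {pred C n} with
  | 0 => fun=> true
  | k.+1 => fun z : C k.+1 => ch_diff C k z == 0
  end.

Fact cycles_submod : GRing.subsemimod_closed ch_cycles.
Proof.
rewrite /ch_cycles; case: n => [|k] //=; split; first split => [|x y].
- by rewrite unfold_in linear0.
- by rewrite !unfold_in linearD => /eqP-> /eqP->; rewrite addr0.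
by move=> a x; rewrite !unfold_in linearZ_LR => /eqP->; rewrite scaler0.
Qed.
HB.instance Definition _ := GRing.isSubmodClosed.Build R (C n) ch_cycles cycles_submod.

Definition ch_cycle : Type := {z : C n | z \in ch_cycles}.
HB.instance Definition _ := SubChoice.on ch_cycle.
HB.instance Definition _ := [SubChoice_isSubLmodule of ch_cycle by <:].

Definition ch_boundaries : {pred ch_cycle} :=
  fun z => `[< exists y : C n.+1, ch_diff C n y = val z >].

Fact boundaries_submod : GRing.subsemimod_closed ch_boundaries.
Proof.
split; first split => [|x y].
- by apply/asboolP; exists 0; rewrite linear0.
- move=> /asboolP[u eu] /asboolP[v ev]; apply/asboolP.
  by exists (u + v); rewrite linearD eu ev.
by move=> a x /asboolP[u eu]; apply/asboolP; exists (a *: u); rewrite linearZ eu.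
Qed.
HB.instance Definition _ :=
  GRing.isSubmodClosed.Build R ch_cycle ch_boundaries boundaries_submod.

Definition homology : Type := Quotient.quot ch_boundaries.
HB.instance Definition _ := GRing.Zmodule.on homology.

Definition hclass (z : ch_cycle) : homology := \pi_(Quotient.quot ch_boundaries)%qT z.
Definition hrepr (h : homology) : ch_cycle := repr (h : Quotient.quot ch_boundaries).

Lemma hreprK : cancel hrepr hclass.
Proof. exact: reprK. Qed.

Lemma eq_hclass z w :
  hclass z = hclass w <-> exists y : C n.+1, ch_diff C n y = val z - val w.
Proof.
have -> : (hclass z = hclass w) <-> (z - w \in ch_boundaries).
  by rewrite Quotient.idealrBE; split=> [e|/eqP//]; apply/eqP.
by split=> [/asboolP|h]; last apply/asboolP.
Qed.

Lemma hclassD : {morph hclass : z w / z + w}.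
Proof. exact: Quotient.pi_add. Qed.

Definition homology_scale (a : R) (h : homology) : homology :=
  hclass (a *: hrepr h).

Lemma hclassZ a z : homology_scale a (hclass z) = hclass (a *: z).
Proof.
have /eq_hclass[y ey] := hreprK (hclass z).
by apply/eq_hclass; exists (a *: y); rewrite linearZ /= ey scalerBr.
Qed.

Fact homology_scaleA a b h :
  homology_scale a (homology_scale b h) = homology_scale (a * b) h.
Proof. by rewrite -(hreprK h) !hclassZ scalerA. Qed.
Fact homology_scale1 : left_id 1 homology_scale.
Proof. by move=> h; rewrite -(hreprK h) hclassZ scale1r. Qed.
Fact homology_scaleDr : right_distributive homology_scale +%R.
Proof.
by move=> a h k; rewrite -(hreprK h) -(hreprK k) -hclassD !hclassZ -hclassD scalerDr.
Qed.
Fact homology_scaleDl h : {morph homology_scale^~ h : a b / a + b}.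
Proof. by move=> a b /=; rewrite -(hreprK h) !hclassZ -hclassD scalerDl. Qed.

HB.instance Definition _ := GRing.Zmodule_isLmodule.Build R homology
  homology_scaleA homology_scale1 homology_scaleDr homology_scaleDl.

Fact hclass_is_linear : linear hclass.
Proof. by move=> a z w; rewrite hclassD -hclassZ. Qed.
HB.instance Definition _ := GRing.isLinear.Build R ch_cycle homology _ hclass
  hclass_is_linear.

Definition hclass_of (z : C n) (hz : z \in ch_cycles) : homology :=
  hclass (Sub z hz).

End Homology.
Arguments ch_cycles {R} C n.
Arguments ch_boundaries {R} C n.

(* The map induced in homology by a chain map of degree -2.                   *)
Section InducedMap.
Variables (R : pzRingType) (C D : chainComplex R).
Variable f : forall n, {linear C n.+2 -> D n}.
Hypothesis f_diff : forall n (x : C n.+3),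
  f n (ch_diff C n.+2 x) = ch_diff D n (f n.+1 x).
Variable n : nat.

Fact cycle_map_subproof (z : ch_cycle C n.+2) : f n (val z) \in ch_cycles D n.
Proof.
move: z; case: n => [|k] // [z hz] /=.
rewrite unfold_in -f_diff; move: hz; rewrite unfold_in => /eqP->.
by rewrite linear0.
Qed.
Definition cycle_map (z : ch_cycle C n.+2) : ch_cycle D n :=
  Sub (f n (val z)) (cycle_map_subproof z).

Definition homology_map (h : homology C n.+2) : homology D n :=
  hclass (cycle_map (hrepr h)).

Lemma homology_mapE z : homology_map (hclass z) = hclass (cycle_map z).
Proof.
have /eq_hclass[y ey] := hreprK (hclass z).
apply/eq_hclass; exists (f n.+1 y).
by rewrite -f_diff ey linearB !SubK.
Qed.

Fact homology_map_is_linear : linear homology_map.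
Proof.
move=> a h k; rewrite -(hreprK h) -(hreprK k) -linearP !homology_mapE -linearP.
by congr hclass; apply: val_inj; rewrite /= linearP.
Qed.
HB.instance Definition _ :=
  GRing.isLinear.Build R (homology C n.+2) (homology D n) _ homology_map
    homology_map_is_linear.

End InducedMap.

(* First-quadrant bicomplexes: bi_obj p q is in column p and row q; the       *)
(* vertical and horizontal differentials anticommute.                         *)
Record bicomplex (R : pzRingType) := Bicomplex {
  bi_obj :> nat -> nat -> lmodType R;
  bi_v : forall p q, {linear bi_obj p q.+1 -> bi_obj p q};
  bi_h : forall p q, {linear bi_obj p.+1 q -> bi_obj p q};
  bi_vK : forall p q (x : bi_obj p q.+2), bi_v p q (bi_v p q.+1 x) = 0;
  bi_hK : forall p q (x : bi_obj p.+2 q), bi_h p q (bi_h p.+1 q x) = 0;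
  bi_vh : forall p q (x : bi_obj p.+1 q.+1),
    bi_v p q (bi_h p q.+1 x) + bi_h p q (bi_v p.+1 q x) = 0 }.
Arguments bi_v {R} B p q : rename.
Arguments bi_h {R} B p q : rename.

Section TotalComplex.
Variables (R : pzRingType) (B : bicomplex R).

Definition antidiag (n : nat) : Type := {pq : nat * nat | (pq.1 + pq.2 == n)%N}.
Definition adcol n (i : antidiag n) : nat := (val i).1.
Definition adrow n (i : antidiag n) : nat := (val i).2.

Definition Antidiag n p q (e : (p + q == n)%N) : antidiag n :=
  @exist _ (fun pq : nat * nat => (pq.1 + pq.2 == n)%N) (p, q) e.

Fact diag_up_subproof n (i : antidiag n) : (adcol i + (adrow i).+1 == n.+1)%N.
Proof. by rewrite addnS eqSS; apply: (valP i). Qed.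
Definition diag_up n (i : antidiag n) : antidiag n.+1 := Antidiag (diag_up_subproof i).

Fact diag_right_subproof n (i : antidiag n) : ((adcol i).+1 + adrow i == n.+1)%N.
Proof. by rewrite addSn eqSS; apply: (valP i). Qed.
Definition diag_right n (i : antidiag n) : antidiag n.+1 := Antidiag (diag_right_subproof i).

Definition tot_obj (n : nat) : lmodType R :=
  prodmod (fun i : antidiag n => B (adcol i) (adrow i)).

Definition tot_diff n (x : tot_obj n.+1) : tot_obj n := fun i =>
  bi_v B (adcol i) (adrow i) (x (diag_up i)) +
  bi_h B (adcol i) (adrow i) (x (diag_right i)).

Fact tot_diff_is_linear n : linear (@tot_diff n).
Proof.
by move=> a x y; apply: prodmodP => i; rewrite /tot_diff !linearP /= addrACA -scalerDr.
Qed.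
HB.instance Definition _ n :=
  GRing.isLinear.Build R (tot_obj n.+1) (tot_obj n) _ (@tot_diff n)
    (@tot_diff_is_linear n).

Fact tot_diffK n (x : tot_obj n.+2) : tot_diff (tot_diff x) = 0.
Proof.
apply: prodmodP => i; rewrite /tot_diff !linearD /= bi_vK bi_hK add0r addr0.
set p := adcol i; set q := adrow i.
have E (e1 e2 : (p.+1 + q.+1 == n.+2)%N) :
    x (Antidiag e1) = x (Antidiag e2) :> B p.+1 q.+1.
  by rewrite (bool_irrelevance e1 e2).
apply: etrans (bi_vh (x (diag_up (diag_right i)) : B p.+1 q.+1)).
congr (bi_v B p q (bi_h B p q.+1 _) + _); exact: E.
Qed.

Definition Tot : chainComplex R :=
  @ChainComplex R tot_obj (fun n => @tot_diff n) tot_diffK.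

End TotalComplex.

(* Cyclic modules with Loday's sign convention for the cyclic operators. The  *)
(* operators are indexed by natural numbers, but only                         *)
(*   cy_d m i : X_(m+1) -> X_m  with i <= m+1,  and                           *)
(*   cy_s m i : X_m -> X_(m+1)  with i <= m                                   *)
(* are part of the structure; the other values are unconstrained and never    *)
(* used.                                                                      *)
Record cyclicModule (R : pzRingType) := CyclicModule {
  cy_obj :> nat -> lmodType R;
  cy_d : forall m, nat -> {linear cy_obj m.+1 -> cy_obj m};
  cy_s : forall m, nat -> {linear cy_obj m -> cy_obj m.+1};
  cy_t : forall m, {linear cy_obj m -> cy_obj m};
  cy_dd : forall m i j (x : cy_obj m.+2), (i <= j <= m.+1)%N ->
    cy_d m i (cy_d m.+1 j.+1 x) = cy_d m j (cy_d m.+1 i x);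
  cy_ss : forall m i j (x : cy_obj m), (i <= j <= m)%N ->
    cy_s m.+1 i (cy_s m j x) = cy_s m.+1 j.+1 (cy_s m i x);
  cy_ds_lt : forall m i j (x : cy_obj m.+1), (i <= j <= m)%N ->
    cy_d m.+1 i (cy_s m.+1 j.+1 x) = cy_s m j (cy_d m i x);
  cy_ds_eq : forall m j (x : cy_obj m), (j <= m)%N ->
    cy_d m j (cy_s m j x) = x;
  cy_ds_eqS : forall m j (x : cy_obj m), (j <= m)%N ->
    cy_d m j.+1 (cy_s m j x) = x;
  cy_ds_gt : forall m i j (x : cy_obj m.+1), (j < i <= m.+1)%N ->
    cy_d m.+1 i.+1 (cy_s m.+1 j x) = cy_s m j (cy_d m i x);
  cy_tK : forall m (x : cy_obj m), iter m.+1 (cy_t m) x = x;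
  cy_dt : forall m i (x : cy_obj m.+1), (i <= m)%N ->
    cy_d m i.+1 (cy_t m.+1 x) = - cy_t m (cy_d m i x);
  cy_d0t : forall m (x : cy_obj m.+1),
    cy_d m 0 (cy_t m.+1 x) = (-1) ^+ m.+1 *: cy_d m m.+1 x;
  cy_st : forall m i (x : cy_obj m), (i < m)%N ->
    cy_s m i.+1 (cy_t m x) = - cy_t m.+1 (cy_s m i x);
  cy_s0t : forall m (x : cy_obj m),
    cy_s m 0 (cy_t m x) = (-1) ^+ m *: cy_t m.+1 (cy_t m.+1 (cy_s m m x)) }.
Arguments cy_d {R} X m i : rename.
Arguments cy_s {R} X m i : rename.
Arguments cy_t {R} X m : rename.

Lemma scaler_signC (R : pzRingType) (V : lmodType R) k (a : R) (v : V) :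
  (-1) ^+ k *: (a *: v) = a *: ((-1) ^+ k *: v).
Proof. by rewrite !scalerA commr_sign. Qed.

Section CyclicBicomplex.
Variables (R : pzRingType) (X : cyclicModule R).

Local Notation d := (cy_d X).
Local Notation t := (cy_t X).

Definition cy_b m (x : X m.+1) : X m := \sum_(i < m.+2) (-1) ^+ i *: d m i x.
Definition cy_b' m (x : X m.+1) : X m := \sum_(i < m.+1) (-1) ^+ i *: d m i x.
Definition cy_N m (x : X m) : X m := \sum_(j < m.+1) iter j (t m) x.
Definition cy_1t m (x : X m) : X m := x - t m x.

Lemma iter_t_is_linear m j : linear (iter j (t m)).
Proof. by move=> a x y; elim: j => //= j ->; rewrite linearP. Qed.
HB.instance Definition _ m j :=
  GRing.isLinear.Build R (X m) (X m) _ (iter j (t m)) (@iter_t_is_linear m j).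

Fact cy_b_is_linear m : linear (@cy_b m).
Proof.
move=> a x y; rewrite /cy_b scaler_sumr -big_split; apply: eq_bigr => i _.
by rewrite linearP scalerDr scaler_signC.
Qed.
HB.instance Definition _ m :=
  GRing.isLinear.Build R (X m.+1) (X m) _ (@cy_b m) (@cy_b_is_linear m).

Fact cy_b'_is_linear m : linear (@cy_b' m).
Proof.
move=> a x y; rewrite /cy_b' scaler_sumr -big_split; apply: eq_bigr => i _.
by rewrite linearP scalerDr scaler_signC.
Qed.
HB.instance Definition _ m :=
  GRing.isLinear.Build R (X m.+1) (X m) _ (@cy_b' m) (@cy_b'_is_linear m).

Fact cy_N_is_linear m : linear (@cy_N m).
Proof.
move=> a x y; rewrite /cy_N scaler_sumr -big_split; apply: eq_bigr => j _.
exact: (@iter_t_is_linear m j).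
Qed.
HB.instance Definition _ m :=
  GRing.isLinear.Build R (X m) (X m) _ (@cy_N m) (@cy_N_is_linear m).

Fact cy_1t_is_linear m : linear (@cy_1t m).
Proof. by move=> a x y; rewrite /cy_1t linearP scalerBr addrACA opprD. Qed.
HB.instance Definition _ m :=
  GRing.isLinear.Build R (X m) (X m) _ (@cy_1t m) (@cy_1t_is_linear m).

Lemma alternating_double_sum (V : lmodType R) n (F : nat -> nat -> V) :
  (forall i j, (i <= j < n)%N -> F i j.+1 = F j i) ->
  \sum_(i < n) \sum_(j < n.+1) (-1) ^+ (i + j) *: F i j = 0.
Proof.
elim: n => [|n IHn] FE; first by rewrite big_ord0.
rewrite big_ord_recr /=.
under eq_bigr do rewrite big_ord_recr /=.
rewrite big_split /= IHn => [|i j /andP[ij jn]]; last first.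
  by apply: FE; rewrite ij ltnW.
rewrite add0r [X in _ + X]big_ord_recr /= addrA.
have -> : \sum_(i < n) (-1) ^+ (i + n.+1) *: F i n.+1 =
          - \sum_(i < n) (-1) ^+ (n + i) *: F n i.
  rewrite -sumrN; apply: eq_bigr => i _.
  by rewrite FE ?ltnSn ?andbT 1?ltnW // addnS exprS mulN1r scaleNr addnC.
rewrite [X in _ + X + _]big_ord_recr /= FE ?leqnn ?ltnSn // addrA addNr add0r.
by rewrite addnS exprS mulN1r scaleNr addrN.
Qed.

Lemma cy_bK m (x : X m.+2) : cy_b (cy_b x) = 0.
Proof.
rewrite -[RHS](@alternating_double_sum _ m.+2 (fun i j => d m i (d m.+1 j x))).
  apply: eq_bigr => i _; rewrite /cy_b linear_sum scaler_sumr.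
  by apply: eq_bigr => j _; rewrite linearZ /= scalerA exprD.
by move=> i j ij; apply: cy_dd.
Qed.

Lemma cy_b'K m (x : X m.+2) : cy_b' (cy_b' x) = 0.
Proof.
rewrite -[RHS](@alternating_double_sum _ m.+1 (fun i j => d m i (d m.+1 j x))).
  apply: eq_bigr => i _; rewrite /cy_b' linear_sum scaler_sumr.
  by apply: eq_bigr => j _; rewrite linearZ /= scalerA exprD.
by move=> i j /andP[ij jm]; apply: cy_dd; rewrite ij ltnW.
Qed.

Lemma cy_b_1t m (x : X m.+1) : cy_b (cy_1t x) = cy_1t (cy_b' x).
Proof.
rewrite /cy_1t linearB /=.
have -> : cy_b (t m.+1 x) = (-1) ^+ m.+1 *: d m m.+1 x + t m (cy_b' x).
  rewrite /cy_b big_ord_recl expr0 scale1r cy_d0t; congr (_ + _).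
  rewrite /cy_b' linear_sum; apply: eq_bigr => i _.
  rewrite linearZ /= cy_dt ?leq_ord //.
  by rewrite exprS mulN1r scaleNr scalerN opprK.
rewrite /cy_b big_ord_recr /= opprD addrA; congr (_ - _).
by rewrite addrK.
Qed.

Lemma cy_N_t m (x : X m) : cy_N (t m x) = cy_N x.
Proof.
rewrite /cy_N big_ord_recr /= -iterSr cy_tK [RHS]big_ord_recl /= addrC.
by congr (_ + _); apply: eq_bigr => i _; rewrite -iterSr.
Qed.

Lemma cy_t_N m (x : X m) : t m (cy_N x) = cy_N x.
Proof.
rewrite -[RHS]cy_N_t /cy_N linear_sum; apply: eq_bigr => i _.
by rewrite /= -iterSr.
Qed.

Lemma cy_N1t m (x : X m) : cy_N (cy_1t x) = 0.
Proof. by rewrite linearB /= cy_N_t subrr. Qed.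

Lemma cy_1tN m (x : X m) : cy_1t (cy_N x) = 0.
Proof. by rewrite /cy_1t cy_t_N subrr. Qed.

Lemma cy_d_iter_le m i j (x : X m.+1) : (j <= i <= m.+1)%N ->
  (-1) ^+ i *: d m i (iter j (t m.+1) x) =
  iter j (t m) ((-1) ^+ (i - j) *: d m (i - j) x).
Proof.
elim: j i => [|j IHj] i; first by rewrite subn0.
case: i => // i /andP[ji im].
rewrite [iter j.+1 _ _]/= cy_dt // exprS mulN1r scaleNr scalerN opprK subSS.
rewrite [in RHS]/= -IHj ?(ltnW im) ?andbT //.
by rewrite linearZ.
Qed.

Lemma cy_d_iter_gt m i l (x : X m.+1) : (i <= l <= m)%N ->
  (-1) ^+ i *: d m i (iter l.+1 (t m.+1) x) =
  iter l (t m) ((-1) ^+ (m.+1 + i - l) *: d m (m.+1 + i - l) x).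
Proof.
elim: i l => [|i IHi] l /andP[il lm].
  rewrite expr0 scale1r addn0 [iter _ _ _]/= cy_d0t.
  by rewrite cy_d_iter_le // leqnn andbT leqW.
case: l il lm => // l il lm.
rewrite [iter l.+2 _ _]/= cy_dt; last exact: leq_trans (ltnW il) lm.
rewrite exprS mulN1r scaleNr scalerN opprK addnS subSS.
rewrite [in RHS]/= -IHi; last by rewrite -ltnS il ltnW.
by rewrite linearZ.
Qed.

Lemma cy_b'N m (x : X m.+1) : cy_b' (cy_N x) = cy_N (cy_b x).
Proof.
pose U l k := iter l (t m) ((-1) ^+ k *: d m k x).
have L i : (i < m.+1)%N -> (-1) ^+ i *: d m i (cy_N x) =
    \sum_(l < m.+1 | (l <= i)%N) U l (i - l)%N +
    \sum_(l < m.+1 | (i <= l)%N) U l (m.+1 + i - l)%N.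
  move=> im; rewrite /cy_N linear_sum scaler_sumr.
  rewrite (bigID (fun j : 'I_m.+2 => (j <= i)%N)) /=; congr (_ + _).
    rewrite [LHS]big_mkcond big_ord_recr /= leqNgt im addr0.
    rewrite [RHS]big_mkcond; apply: eq_bigr => l _ /=; case: ifP => // li.
    by rewrite cy_d_iter_le // li leqW // ltnW.
  rewrite [LHS]big_mkcond big_ord_recl /= add0r.
  rewrite [RHS]big_mkcond; apply: eq_bigr => l _ /=.
  rewrite /bump /= add1n -ltnNge ltnS; case: ifP => // il.
  by rewrite cy_d_iter_gt // il -ltnS ltn_ord.
rewrite /cy_b'; under eq_bigr do rewrite L //.
rewrite big_split /= (exchange_big_dep predT) //= [X in _ + X](exchange_big_dep predT) //=.
rewrite -big_split /= /cy_N; apply: eq_bigr => l _.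
have lm : (l <= m)%N by rewrite -ltnS.
rewrite /cy_b linear_sum /=.
transitivity (\sum_(k < m.+2) U l k); last by [].
rewrite -(big_mkord xpredT (U l)) (@big_cat_nat _ _ _ (m.+1 - l)) //=; last first.
  by apply: leq_trans (leq_subr _ _) _.
congr (_ + _).
  rewrite -(big_mkord (fun i => (l <= i)%N) (fun i => U l (i - l)%N)).
  rewrite (@big_cat_nat _ _ _ l) //=; last exact: leqW.
  rewrite big_nat_cond big1 ?add0r => [|i /andP[/andP[_ il]]]; last first.
    by rewrite leqNgt il.
  rewrite -{1}[nat_of_ord l]add0n big_addn big_mkord.
  rewrite big_mkord; apply: eq_big => [i|i _]; first by rewrite leq_addl.
  by rewrite addnK.
rewrite -(big_mkord (fun i => (i <= l)%N) (fun i => U l (m.+1 + i - l)%N)).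
rewrite (@big_cat_nat _ _ _ l.+1) //=.
rewrite [X in _ + X]big_nat_cond [X in _ + X]big1 ?addr0 => [|i /andP[/andP[li _]]]; last first.
  by rewrite leqNgt li.
rewrite -{1}[(m.+1 - l)%N]add0n big_addn.
have -> : (m.+2 - (m.+1 - l) = l.+1)%N by rewrite subSn ?leq_subr // subKn // leqW.
rewrite big_nat_cond [RHS]big_nat; apply: eq_big => [i|i /andP[_ il]].
  by rewrite !leq0n /= ltnS andbb.
by rewrite addnC addnBA ?leqW // addnC.
Qed.

Definition CC_obj (p q : nat) : lmodType R := X q.

Definition CC_v p q : {linear CC_obj p q.+1 -> CC_obj p q} :=
  if odd p then [the {linear X q.+1 -> X q} of \- @cy_b' q]
  else [the {linear X q.+1 -> X q} of @cy_b q].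

(* From column p.+1, which is odd exactly when p is even, to column p.        *)
Definition CC_h p q : {linear CC_obj p.+1 q -> CC_obj p q} :=
  if odd p.+1 then [the {linear X q -> X q} of @cy_1t q]
  else [the {linear X q -> X q} of @cy_N q].

Fact CC_vK p q (x : CC_obj p q.+2) : CC_v p q (CC_v p q.+1 x) = 0.
Proof.
rewrite /CC_v; case: odd => /=; last exact: cy_bK.
by rewrite linearN /= cy_b'K !oppr0.
Qed.

Fact CC_hK p q (x : CC_obj p.+2 q) : CC_h p q (CC_h p.+1 q x) = 0.
Proof. by rewrite /CC_h /=; case: odd => /=; [apply: cy_N1t | apply: cy_1tN]. Qed.

Fact CC_vh p q (x : CC_obj p.+1 q.+1) :
  CC_v p q (CC_h p q.+1 x) + CC_h p q (CC_v p.+1 q x) = 0.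
Proof.
rewrite /CC_h /CC_v /=; case: odd => /=; first by rewrite cy_b'N addNr.
by rewrite linearN cy_b_1t subrr.
Qed.

Definition CC : bicomplex R := @Bicomplex R CC_obj CC_v CC_h CC_vK CC_hK CC_vh.

Definition HC (n : nat) : lmodType R := homology (Tot CC) n.

(* The quotient of CC by its first two columns, on total complexes: the       *)
(* summands in columns 0 and 1 are killed, and column p.+2 of CC is identified *)
(* with column p.                                                             *)
Fact drop2_subproof n (i : antidiag n) : ((adcol i).+2 + adrow i == n.+2)%N.
Proof. by rewrite !addSn !eqSS; apply: (valP i). Qed.
Definition drop2 n (x : Tot CC n.+2) : Tot CC n :=
  fun i => x (Antidiag (drop2_subproof i)) : X (adrow i).

Fact drop2_is_linear n : linear (@drop2 n).
Proof. by []. Qed.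
HB.instance Definition _ n :=
  GRing.isLinear.Build R (Tot CC n.+2) (Tot CC n) _ (@drop2 n)
    (@drop2_is_linear n).

Fact drop2_diff n (x : Tot CC n.+3) :
  drop2 (ch_diff (Tot CC) n.+2 x) = ch_diff (Tot CC) n (drop2 x).
Proof.
apply: prodmodP => i; rewrite /drop2 /= /tot_diff /= /CC_v /CC_h.
set p := adcol i; set q := adrow i.
have E p' q' (e1 e2 : (p' + q' == n.+3)%N) : x (Antidiag e1) = x (Antidiag e2) :> X q'.
  by rewrite (bool_irrelevance e1 e2).
rewrite /= !negbK; case: odd => /=.
  congr (- cy_b' (_ : X q.+1) + cy_N (_ : X q)); exact: E.
congr (cy_b (_ : X q.+1) + cy_1t (_ : X q)); exact: E.
Qed.

Definition connes_S n : {linear HC n.+2 -> HC n} :=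
  [the {linear _ -> _} of @homology_map R _ _ (fun n => @drop2 n) drop2_diff n].

Definition cyK_pred : {pred prodmod X} := fun x =>
  `[< (forall m, t m (x m) = (-1) ^+ m *: x m) /\
      (forall m i, (i <= m.+1)%N -> d m i (x m.+1) = x m) >].

Fact cyK_submod : GRing.subsemimod_closed cyK_pred.
Proof.
split; first split => [|x y].
- by apply/asboolP; split=> [m|m i _]; rewrite linear0 ?scaler0.
- move=> /asboolP[xt xd] /asboolP[yt yd]; apply/asboolP; split=> [m|m i im].
    by rewrite linearD xt yt -scalerDr.
  by rewrite linearD xd ?yd.
move=> a x /asboolP[xt xd]; apply/asboolP; split=> [m|m i im].
  by rewrite linearZ /= xt scaler_signC.
by rewrite linearZ /= xd.
Qed.
HB.instance Definition _ :=
  GRing.isSubmodClosed.Build R (prodmod X) cyK_pred cyK_submod.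

Definition cyK : Type := {x : prodmod X | x \in cyK_pred}.
HB.instance Definition _ := SubChoice.on cyK.
HB.instance Definition _ := [SubChoice_isSubLmodule of cyK by <:].

(* The summand X_m of Tot_(2n) CC, 0 <= m <= 2n, is the one in row m (and     *)
(* column 2n - m). The division of factorials is exact.                       *)
Definition cy_ch n (x : prodmod X) : Tot CC n.*2 := fun i =>
  let m := adrow i in (-1) ^+ m./2 *: (x m *+ (m`! %/ (m./2)`!)) : X m.

End CyclicBicomplex.

Arguments cy_ch {R} X n x : rename.

(* Main.v *)
Require Import Defs.
From mathcomp Require Import all_boot all_order all_algebra.
From mathcomp Require Import boolp.
Import GRing.Theory.
Local Open Scope ring_scope.

(** On an element of [cyK X] the operators of the bicomplex act by scalars: b and
    b' send x_(q+1) to x_q when q is odd and even respectively, 1 - t multiplies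
    x_q by 2 when q is odd, and N multiplies x_q by q + 1 when q is even. Writing
    c_m for the coefficients of the chain, the cycle condition thus reduces to
    c_(2k+1) = (2k+1) c_(2k) and c_(2k+2) = - 2 c_(2k+1). As c_m does not depend
    on n, dropping two columns sends ch_(n+1) to ch_n already on chains. *)

(** Makes the truncated divisions in the coefficients exact, so factors can move across [%/]. *)
Lemma fact_dvd_fact m n : (m <= n)%N -> (m`! %| n`!)%N.
Proof. by move=> le_mn; rewrite -(bin_fact le_mn) mulnCA dvdn_mulr. Qed.

Lemma fact_half_oddS k :
  ((k.*2.+1)`! %/ k`! = k.*2.+1 * ((k.*2)`! %/ k`!))%N.
Proof. by rewrite factS muln_divA // fact_dvd_fact // -addnn leq_addr. Qed.

(** The factor 2k+2 gained by the numerator is twice the factor k+1 gained by the denominator. *)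
Lemma fact_half_evenS k :
  ((k.+1.*2)`! %/ (k.+1)`! = 2 * ((k.*2.+1)`! %/ k`!))%N.
Proof.
rewrite muln_divA; last by rewrite fact_dvd_fact // leqW // -addnn leq_addr.
have -> : ((k.+1.*2)`! = k.+1 * (2 * (k.*2.+1)`!))%N.
  by rewrite doubleS factS -doubleS -mul2n mulnA (mulnC k.+1).
by rewrite (factS k) divnMl.
Qed.

(** All faces of x_(q+1) equal x_q, so b and b' reduce to this sum with q+2 and q+1 terms. *)
Lemma sum_signZ {R : pzRingType} {V : lmodType R} (v : V) m :
  \sum_(i < m) (-1) ^+ i *: v = if odd m then v else 0.
Proof.
elim: m => [|m IHm]; first by rewrite big_ord0.
rewrite big_ord_recr /= IHm -signr_odd; case: (odd m) => /=.
  by rewrite expr1 scaleN1r addrN.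
by rewrite expr0 scale1r add0r.
Qed.

Section CyclicInvariants.
Variables (R : pzRingType) (X : cyclicModule R) (x : cyK X).
Implicit Types m n : nat.

Lemma cyK_t m : cy_t X m (val x m) = (-1) ^+ m *: val x m.
Proof. by have /asboolP[xt _] := valP x; apply: xt. Qed.

Lemma cyK_d m i : (i <= m.+1)%N -> cy_d X m i (val x m.+1) = val x m.
Proof. by have /asboolP[_ xd] := valP x; apply: xd. Qed.

Lemma cy_b_cyK m : odd m -> cy_b (val x m.+1) = val x m.
Proof.
move=> odd_m; have := sum_signZ (val x m) m.+2; rewrite /= negbK odd_m => <-.
apply: eq_bigr => i _.
by rewrite cyK_d // -ltnS.
Qed.

Lemma cy_b'_cyK m : ~~ odd m -> cy_b' (val x m.+1) = val x m.
Proof.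
move=> even_m; have := sum_signZ (val x m) m.+1; rewrite /= even_m => <-.
apply: eq_bigr => i _.
by rewrite cyK_d // ltnW.
Qed.

Lemma cy_1t_cyK m : odd m -> cy_1t (val x m) = val x m *+ 2.
Proof.
by move=> odd_m; rewrite /cy_1t cyK_t -signr_odd odd_m expr1 scaleN1r opprK.
Qed.

Lemma cy_N_cyK m : ~~ odd m -> cy_N (val x m) = val x m *+ m.+1.
Proof.
move=> even_m; rewrite /cy_N (eq_bigr (fun=> val x m)) ?sumr_const ?card_ord //.
move=> i _; elim: (nat_of_ord i) => //= j ->.
by rewrite cyK_t -signr_odd (negbTE even_m) expr0 scale1r.
Qed.

Let ch_term m : X m := (-1) ^+ m./2 *: (val x m *+ (m`! %/ (m./2)`!)).

(** For even q the signs in rows q and q+1 agree; the minus before b' gives the cancellation. *)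
Lemma cy_b'N_ch_term q :
  ~~ odd q -> - cy_b' (ch_term q.+1) + cy_N (ch_term q) = 0.
Proof.
move=> even_q; apply/eqP; rewrite addrC subr_eq0 /ch_term !linearZ /= !linearMn /=.
rewrite cy_b'_cyK // cy_N_cyK //.
rewrite -(even_halfK even_q); move: q./2 => k.
by rewrite uphalf_double doubleK fact_half_oddS -mulrnA.
Qed.

(** For odd q the half grows by one from row q to row q+1, and this sign change gives the
    cancellation. *)
Lemma cy_b1t_ch_term q :
  odd q -> cy_b (ch_term q.+1) + cy_1t (ch_term q) = 0.
Proof.
move=> odd_q; rewrite /ch_term !linearZ /= !linearMn /=.
rewrite cy_b_cyK // cy_1t_cyK //.
have -> : q = (q./2).*2.+1 by rewrite odd_halfK // prednK // odd_gt0.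
move: q./2 => k; rewrite /= !uphalf_double doubleK.
by rewrite -doubleS fact_half_evenS -mulrnA exprS mulN1r scaleNr addNr.
Qed.

Lemma cy_ch_cycle n : cy_ch X n (val x) \in ch_cycles (Tot (CC X)) n.*2.
Proof.
case: n => [//|n]; rewrite unfold_in; apply/eqP/prodmodP => i.
(* The boundary has odd degree, so odd columns meet even rows and even columns odd rows. *)
have : odd (adcol i + adrow i).
  by rewrite (eqP (valP i : adcol i + adrow i == n.*2.+1)%N) /= odd_double.
rewrite /= /tot_diff /= /CC_v /CC_h /= oddD.
case: (odd (adcol i)) => /= odd_q; first exact: cy_b'N_ch_term.
exact: cy_b1t_ch_term.
Qed.

End CyclicInvariants.

Theorem proposition2p7 (R : pzRingType) (X : cyclicModule R) (x : cyK X) :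
  exists hz : forall n, cy_ch X n (val x) \in ch_cycles (Tot (CC X)) n.*2,
  forall n, connes_S X n.*2 (hclass_of (hz n.+1)) = hclass_of (hz n).
Proof.
exists (cy_ch_cycle R X x) => n.
(* The underlying chains are convertible: a component depends only on its row, which [drop2]
   preserves. *)
rewrite [LHS]homology_mapE /hclass_of; congr hclass; exact: val_inj.
Qed.
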